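(* Let $G$ be a graph of order $n\geq 5$ such that neither $G$ nor its complement $\overline{G}$ has an isolated vertex. Then $$2n-6\leq \gamma_{t}^{oi}(G)\cdot\gamma_{t}^{oi}(\overline{G})\leq (n-1)^{2}.$$ Moreover, equality holds in the lower bound if and only if $G\in\Lambda$ or $\overline{G}\in\Lambda$, and equality holds in the upper bound if and only if $G=C_{5}$ (the cycle on five vertices).
   Context: All graphs are finite and simple; $\overline{G}$ is the complement of $G$, and equality of graphs means isomorphism. For a graph $G$ without isolated vertices, a total outer-independent dominating set (TOID set) is a set $S\subseteq V(G)$ such that every vertex of $V(G)$ has at least one neighbor in $S$ and $V(G)\setminus S$ is an independent set. The TOID number $\gamma_{t}^{oi}(G)$ is the smallest cardinality of a TOID set of $G$. The family $\Lambda$ consists of all graphs $G$ of order $n\geq5$ obtained as follows. Begin with a path $P_2$ on two (adjacent) vertices $a$ and $b$. Add a set $K$ of $n-2$ new vertices. Add some edges with one end point in $\{a,b\}$ and the other one in $K$ (no other edges are added, so $K$ is independent), in such a way that $K$ is partitioned into three nonempty sets $A,B,C$, where $A$ is the set of vertices of $K$ adjacent only to $a$, $B$ is the set of vertices of $K$ adjacent only to $b$, and $C$ is the set of vertices of $K$ adjacent to both $a$ and $b$. *)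

(* Defs.v *)
From mathcomp Require Import all_boot.

Set Implicit Arguments.
Unset Strict Implicit.
Unset Printing Implicit Defensive.

Record sgraph := SGraph {
  vertex :> finType;
  adj : rel vertex;
  adj_sym : symmetric adj;
  adj_irrefl : irreflexive adj }.

Definition isolated (G : sgraph) (v : G) : bool := [forall u, ~~ adj v u].

Definition no_isolated (G : sgraph) : bool := [forall v : G, ~~ isolated v].

Definition independent (G : sgraph) (S : {set G}) : bool :=
  [forall u in S, forall v in S, ~~ adj u v].

Definition iso (G H : sgraph) : Prop :=
  exists2 f : G -> H, bijective f & forall u v, adj (f u) (f v) = adj u v.

Section Complement.
Variable G : sgraph.
Definition compl_adj : rel G := [rel u v | (u != v) && ~~ adj u v].
Lemma compl_adj_sym : symmetric compl_adj.
Proof. by move=> u v; rewrite /compl_adj /= eq_sym adj_sym. Qed.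
Lemma compl_adj_irrefl : irreflexive compl_adj.
Proof. by move=> u; rewrite /compl_adj /= eqxx. Qed.
Definition compl : sgraph := SGraph compl_adj_sym compl_adj_irrefl.
End Complement.

Definition C5_adj : rel 'I_5 := [rel i j | (j == ordS i) || (i == ordS j)].
Lemma C5_adj_sym : symmetric C5_adj.
Proof. by move=> i j; rewrite /C5_adj /= orbC. Qed.
Lemma C5_adj_irrefl : irreflexive C5_adj.
Proof. by case=> [[|[|[|[|[|i]]]]] lt_i]. Qed.
Definition C5 : sgraph := SGraph C5_adj_sym C5_adj_irrefl.

Definition TOID_set (G : sgraph) (S : {set G}) : bool :=
  [forall v, exists u in S, adj v u] && independent (~: S).

(* When [G] has no isolated vertex, [setT] is a TOID set, so this is the true
   minimum; for other graphs no TOID set exists and the value is #|G|. *)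
Definition TOID_number (G : sgraph) : nat :=
  #|[arg min_(S < [set: G] | TOID_set S) #|S| ]|.

(* The construction is read inside [G], which makes the family closed under
   isomorphism: K = ~: [set a; b] is the set of added vertices. *)
Definition in_Lambda (G : sgraph) : Prop :=
  5 <= #|G| /\
  exists a b : G,
    let K := ~: [set a; b] in
    let A := [set x in K | adj x a && ~~ adj x b] in
    let B := [set x in K | adj x b && ~~ adj x a] in
    let C := [set x in K | adj x a && adj x b] in
    [/\ adj a b, independent K, A :|: B :|: C = K &
        [/\ A != set0, B != set0 & C != set0]].

(* Main.v *)
Require Import Defs.
From mathcomp Require Import all_boot zify.

Set Implicit Arguments.
Unset Strict Implicit.
Unset Printing Implicit Defensive.

(** Write [g] and [g'] for the TOID numbers of [G] and [compl G], and [n] for the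
    order.

    Lower bound: what a TOID set of [G] leaves out is an independent set, what a
    TOID set of [compl G] leaves out is a clique of [G], and these share at most
    one vertex; hence [g + g' >= n - 1] ([TOID_number_sum]). As [g] and [g'] are
    at least 2, this gives [g * g' >= 2 * (n - 3)], with equality exactly when
    one of them is 2 and the other [n - 3]. Such an extremal pair amounts to an
    edge of [G] meeting all edges together with a triangle on it, which is the
    family Lambda ([TOID_number_Lambda], [Lambda_TOID_number]).

    Upper bound: [g = n] forces [G] to be a perfect matching, and then
    [g' <= n - 2] ([TOID_order_degree], [TOID_compl_degree1]), so the product is
    at most [n * (n - 2) < (n - 1) ^ 2]. Otherwise [g] and [g'] are at most
    [n - 1]. Equality means that no two nonadjacent vertices can be left out, in
    [G] and in [compl G]: every pair of vertices contains a neighbourhood of one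
    of the two graphs ([TOID_crowdedP]). This excludes leaves
    ([crowded_compl_degree]), so every pair is a neighbourhood; counting pairs
    gives [n = 5] and degree two ([crowded_two_regular]), that is, the five-cycle
    ([two_regular_C5]). *)

(** * Finite sets and neighbourhoods *)

Lemma card_pair (T : finType) (a b : T) : a != b -> #|[set a; b]| = 2.
Proof. by rewrite cards2 => ->. Qed.

Lemma card_triple (T : finType) (a b c : T) :
  a != b -> a != c -> b != c -> #|[set a; b; c]| = 3.
Proof.
move=> ab ac bc; rewrite setUC cardsU1 card_pair // !inE.
by rewrite ![c == _]eq_sym (negPf ac) (negPf bc).
Qed.

Lemma ex_notin (T : finType) (s : seq T) : size s < #|T| -> exists x, x \notin s.
Proof.
move=> lt_s; apply/existsP; rewrite -negb_forall; apply: contraL lt_s.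
move/forallP=> s_all; rewrite -leqNgt (leq_trans _ (card_size s)) //.
by apply: subset_leq_card; apply/subsetP=> x _; apply: s_all.
Qed.

Definition nbrs (G : sgraph) (v : G) : {set G} := [set u | adj v u].

Lemma in_nbrs (G : sgraph) (u v : G) : (u \in nbrs v) = adj v u.
Proof. by rewrite inE. Qed.

Lemma adj_neq (G : sgraph) (u v : G) : adj u v -> u != v.
Proof. by apply: contraTneq => ->; rewrite adj_irrefl. Qed.

Lemma no_isolatedP (G : sgraph) :
  reflect (forall v : G, exists u, adj v u) (no_isolated G).
Proof.
apply: (iffP forallP) => noG v.
  by have /forallPn[u /negPn] := noG v; exists u.
by have [u vu] := noG v; apply/forallPn; exists u; rewrite negbK.
Qed.

(** * Total outer-independent domination *)

Lemma TOID_setP (G : sgraph) (S : {set G}) :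
  reflect ((forall v, exists2 u, u \in S & adj v u) /\
           (forall u v, u \notin S -> v \notin S -> ~~ adj u v))
          (TOID_set S).
Proof.
apply: (iffP andP) => [[/forallP domS /forall_inP indS]|[domS indS]]; split.
- by move=> v; have /exists_inP[u] := domS v; exists u.
- move=> u v Su Sv; have /indS/forall_inP/(_ v) : u \in ~: S by rewrite inE.
  by apply; rewrite inE.
- by apply/forallP=> v; apply/exists_inP.
- apply/forall_inP=> u; rewrite inE => Su.
  by apply/forall_inP=> v; rewrite inE; apply: indS.
Qed.

Lemma TOID_setT (G : sgraph) : no_isolated G -> TOID_set [set: G].
Proof.
move/no_isolatedP=> noG; apply/TOID_setP; split=> [v|u v]; last by rewrite inE.
by have [u] := noG v; exists u.
Qed.

Lemma TOID_number_min (G : sgraph) (S : {set G}) :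
  TOID_set S -> TOID_number G <= #|S|.
Proof.
move=> SP; rewrite /TOID_number; case: arg_minnP => [|T _ minT]; last exact: minT.
apply: TOID_setT; apply/no_isolatedP=> v.
by have /TOID_setP[/(_ v)[u _]] := SP; exists u.
Qed.

Lemma TOID_number_attained (G : sgraph) :
  no_isolated G -> exists2 S : {set G}, TOID_set S & #|S| = TOID_number G.
Proof.
move=> noG; rewrite /TOID_number.
by case: arg_minnP => [|T TP _]; [apply: TOID_setT | exists T].
Qed.

Lemma TOID_number_le_order (G : sgraph) : no_isolated G -> TOID_number G <= #|G|.
Proof. by move/TOID_setT/TOID_number_min; rewrite cardsT. Qed.

Lemma TOID_number_ge2 (G : sgraph) :
  0 < #|G| -> no_isolated G -> 2 <= TOID_number G.
Proof.
case/card_gt0P=> v _ /TOID_number_attained[S /TOID_setP[domS _] <-].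
have [u Su _] := domS v; have [w Sw uw] := domS u.
by rewrite -(card_pair (adj_neq uw)) subset_leq_card // subUset !sub1set Su.
Qed.

(** * Complements *)

Lemma adj_compl (G : sgraph) (u v : G) :
  @adj (compl G) u v = (u != v) && ~~ adj u v.
Proof. by []. Qed.

Lemma no_isolated_complP (G : sgraph) :
  reflect (forall v : G, exists2 u, v != u & ~~ adj v u) (no_isolated (compl G)).
Proof.
apply: (iffP (@no_isolatedP (compl G))) => noG v; have [u] := noG v.
  by case/andP; exists u.
by move=> ? ?; exists u; apply/andP.
Qed.

Lemma adj_complK (G : sgraph) (u v : G) : @adj (compl (compl G)) u v = adj u v.
Proof.
rewrite !adj_compl; case: eqVneq => [->|_] /=; first by rewrite adj_irrefl.
by rewrite negbK.
Qed.

Lemma no_isolated_complK (G : sgraph) :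
  no_isolated (compl (compl G)) = no_isolated G.
Proof.
by apply/no_isolatedP/no_isolatedP=> noG v; have [u vu] := noG v; exists u;
   move: vu; rewrite adj_complK.
Qed.

Lemma TOID_set_complK (G : sgraph) (S : {set G}) :
  @TOID_set (compl (compl G)) S = TOID_set S.
Proof.
apply/TOID_setP/TOID_setP=> [][domS indS]; split=> [v|u v Su Sv].
- by have [u Su vu] := domS v; exists u => //; move: vu; rewrite adj_complK.
- by have := indS u v Su Sv; rewrite adj_complK.
- by have [u Su vu] := domS v; exists u => //; rewrite adj_complK.
- by rewrite adj_complK indS.
Qed.

Lemma TOID_number_complK (G : sgraph) :
  TOID_number (compl (compl G)) = TOID_number G.
Proof.
rewrite /TOID_number /arg_min /extremum.
congr #|pred_of_set (odflt _ _)|; apply: eq_pick => S /=.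
by rewrite TOID_set_complK; congr (_ && _); apply: eq_forallb => T;
   rewrite TOID_set_complK.
Qed.

Lemma card_nbrs_compl (G : sgraph) (v : G) :
  #|nbrs v| + #|@nbrs (compl G) v| = #|G|.-1.
Proof.
have -> : @nbrs (compl G) v = ~: (v |: nbrs v).
  by apply/setP=> u; rewrite !inE adj_compl negb_or eq_sym.
have := cardsC (v |: nbrs v); rewrite cardsU1 in_nbrs adj_irrefl.
by move=> <-.
Qed.

(** * The lower bound *)

(** The complement of a TOID set of [G] is independent in [G], that of a TOID
    set of [compl G] is a clique of [G]. *)
Lemma card_TOID_compl_meet (G : sgraph) (S : {set G}) (S' : {set compl G}) :
  TOID_set S -> TOID_set S' -> #|~: S :&: ~: S'| <= 1.
Proof.
move=> /TOID_setP[_ indS] /TOID_setP[_ indS'].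
apply/card_le1_eqP=> u v; rewrite !inE => /andP[uS uS'] /andP[vS vS'].
have := indS' u v uS' vS'; rewrite adj_compl negb_and !negbK.
by rewrite (negPf (indS u v uS vS)) orbF => /eqP.
Qed.

Lemma TOID_number_sum (G : sgraph) :
  no_isolated G -> no_isolated (compl G) ->
  #|G| <= (TOID_number G + TOID_number (compl G)).+1.
Proof.
move=> /TOID_number_attained[S toidS <-] /TOID_number_attained[S' toidS' <-].
have meet1 := card_TOID_compl_meet toidS toidS'.
have le_n : #|~: S :|: ~: S'| <= #|G| := max_card _.
have cS : #|S| + #|~: S| = #|G| := cardsC S.
have cS' : #|S'| + #|~: S'| = #|G| := cardsC S'.
have : #|~: S :|: ~: S'| + #|~: S :&: ~: S'| = #|~: S| + #|~: S'| := cardsUI _ _.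
lia.
Qed.

(** The pair [{a, b}] is a TOID set of [G], and with [c] in the class [C] the
    triangle [{a, b, c}] is the complement of a TOID set of [compl G]: there the
    class [B] dominates [a], the class [A] dominates [b], and the rest of the
    independent set [K] is a clique with at least two vertices. *)
Lemma Lambda_TOID_number (G : sgraph) :
  in_Lambda G -> TOID_number G <= 2 /\ TOID_number (compl G) <= #|G| - 3.
Proof.
case=> _ [a [b [ab /forall_inP indK partK]]].
case=> /set0Pn[x Ax] /set0Pn[y By] /set0Pn[c Cc].
have ba : adj b a by rewrite adj_sym.
move: Ax By Cc; rewrite !inE => /andP[Kx /andP[xa xb]] /andP[Ky /andP[yb ya]].
case/andP=> Kc /andP[ca cb].
have nKadj u v : u \notin [set a; b] -> v \notin [set a; b] -> ~~ adj u v.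
  move=> Ku Kv; have /indK/forall_inP/(_ v) : u \in ~: [set a; b] by rewrite inE.
  by apply; rewrite inE.
split.
  rewrite -(card_pair (adj_neq ab)); apply: TOID_number_min.
  apply/TOID_setP; split=> // v.
  have [|Kv] := boolP (v \in [set a; b]).
    rewrite !inE => /orP[]/eqP->; first by exists b; rewrite // !inE eqxx orbT.
    by exists a; rewrite // !inE eqxx.
  have : v \in ~: [set a; b] by rewrite inE.
  rewrite -partK !inE => /orP[/orP[]|] /andP[_ /andP[va vb]].
  - by exists a; rewrite // !inE eqxx.
  - by exists b; rewrite // !inE eqxx orbT.
  - by exists a; rewrite // !inE eqxx.
have ac : adj a c by rewrite adj_sym.
have bc : adj b c by rewrite adj_sym.
have neq_xc : x != c by apply: contraNneq xb => ->.
have neq_yc : y != c by apply: contraNneq ya => ->.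
have <- : #|~: [set a; b; c]| = #|G| - 3.
  by rewrite cardsCs setCK card_triple ?adj_neq.
have xS : x \in ~: [set a; b; c] by rewrite !inE negb_or Kx.
have yS : y \in ~: [set a; b; c] by rewrite !inE negb_or Ky.
apply: (@TOID_number_min (compl G)); apply/TOID_setP; split=> [v|u v].
  have [|Kv] := boolP (v \in [set a; b]).
    rewrite !inE => /orP[]/eqP->; [exists y | exists x] => //; rewrite adj_compl.
      by rewrite adj_sym ya andbT; apply: contraNneq Ky => <-; rewrite eqxx.
    by rewrite adj_sym xb andbT; apply: contraNneq Kx => <-; rewrite eqxx orbT.
  have neq_xy : x != y by apply: contraNneq ya => <-.
  have [->|neq_vx] := eqVneq v x.
    by exists y => //; rewrite adj_compl neq_xy nKadj // !inE.
  by exists x => //; rewrite adj_compl neq_vx nKadj // !inE.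
rewrite !inE !negbK => /orP[/orP[]|] /eqP-> /orP[/orP[]|] /eqP->;
  by rewrite adj_compl ?eqxx // ?(ab, ba, ac, ca, bc, cb) andbF.
Qed.

(** A minimum TOID set of [G] is the edge [{a, b}]; a minimum TOID set of
    [compl G] omits three vertices, a triangle of [G], which is forced to be
    [{a, b, c}] with [c] in the class [C]. The classes [A] and [B] are nonempty
    because [b] and [a] are not isolated in [compl G]. *)
Lemma TOID_number_Lambda (G : sgraph) :
  5 <= #|G| -> no_isolated G -> no_isolated (compl G) ->
  TOID_number G = 2 -> TOID_number (compl G) = #|G| - 3 -> in_Lambda G.
Proof.
move=> n5 noG noG' g2 g'n; split=> //.
have [S toidS] := TOID_number_attained noG.
have [S' toidS'] := TOID_number_attained noG'.
rewrite g2 g'n => cS' /eqP/cards2P[a [b [neq_ab defS]]].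
have le1 : #|~: S' :&: ~: S| <= 1.
  by rewrite setIC; apply: card_TOID_compl_meet toidS toidS'.
have /TOID_setP[domS indS] := toidS; have /TOID_setP[_ indS'] := toidS'.
have domab v : adj v a || adj v b.
  by have [u] := domS v; rewrite defS !inE => /orP[]/eqP-> ->; rewrite ?orbT.
have ab : adj a b by have := domab a; rewrite adj_irrefl.
have cT : #|~: S'| = 3 by have : #|S'| + #|~: S'| = #|G| := cardsC S'; lia.
(* The triangle [~: S'] has at most one vertex outside the pair [S]. *)
have cTS : #|~: S' :&: S| + #|~: S' :&: ~: S| = 3.
  by rewrite -cT -setDE; apply: (@cardsID G S (~: S')).
have cS : #|S| = 2 by rewrite defS card_pair.
have le2 : #|~: S' :&: S| <= 2 by rewrite -cS (subset_leq_card (subsetIr _ _)).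
have SS' : S \subset ~: S'.
  have /eqP <- : ~: S' :&: S == S; last exact: subsetIl.
  by rewrite eqEcard subsetIr cS; move: cTS le1; clear; lia.
have /card_gt0P[c] : 0 < #|~: S' :&: ~: S| by move: cTS le2; clear; lia.
rewrite in_setI !in_setC => /andP[cS'' cSn].
have adjc u : u \in S -> @adj G c u.
  move=> Su; have := subsetP SS' u Su; rewrite inE => uS'.
  have := indS' c u cS'' uS'; rewrite adj_compl negb_and !negbK.
  by case/orP=> [/eqP eq_cu|//]; rewrite eq_cu Su in cSn.
exists a, b; split=> //.
- rewrite /= -defS; apply/forall_inP=> u; rewrite in_setC => Ku.
  by apply/forall_inP=> v; rewrite in_setC; apply: indS.
- apply/setP=> v; have := domab v; rewrite !inE.
  by case: (adj v a); case: (adj v b); case: ((v == a) || (v == b)).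
move/no_isolated_complP: noG' => noG'.
split; apply/set0Pn.
- have [x bx nbx] := noG' b; rewrite adj_sym in nbx.
  have xa : adj x a by have := domab x; rewrite (negPf nbx) orbF.
  by exists x; rewrite !inE xa nbx negb_or (adj_neq xa) eq_sym bx.
- have [x ax nax] := noG' a; rewrite adj_sym in nax.
  have xb : adj x b by have := domab x; rewrite (negPf nax).
  by exists x; rewrite !inE xb nax negb_or (adj_neq xb) eq_sym ax.
by exists c; rewrite in_set in_setC -defS cSn !adjc // defS !inE ?eqxx ?orbT.
Qed.

(** * TOID numbers close to the order *)

(** If the whole vertex set is the only TOID set, no single vertex [u] can be
    left out, so some vertex [f u] is a leaf at [u]; [f] is injective, hence onto,
    and every vertex is a leaf. *)
Lemma TOID_order_degree (G : sgraph) (v : G) :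
  no_isolated G -> TOID_number G = #|G| -> #|nbrs v| <= 1.
Proof.
move=> noG gn.
have leaf (u : G) : exists w, nbrs w \subset [set u].
  apply/existsP; apply: contraT; rewrite negb_exists => /forallP noleaf.
  have : TOID_set (~: [set u]).
    apply/TOID_setP; split=> [w|w w'].
      have /subsetPn[x] := noleaf w; rewrite in_nbrs in_set1 => wx ux.
      by exists x; rewrite // !inE.
    by rewrite !inE !negbK => /eqP-> /eqP->; rewrite adj_irrefl.
  move/TOID_number_min; rewrite gn cardsCs setCK cards1.
  by have : 0 < #|G| by [apply/card_gt0P; exists u]; lia.
have [f leaff] := fin_all_exists leaf.
have f_inj : injective f.
  move=> u w eq_fuw; move/no_isolatedP: noG => /(_ (f u))[x fx].
  have := subsetP (leaff u) x; have := subsetP (leaff w) x.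
  rewrite -eq_fuw !in_nbrs fx !in_set1 => /(_ isT)/eqP <- /(_ isT)/eqP //.
have /codomP[u ->] := injF_onto f_inj v.
by rewrite (leq_trans (subset_leq_card (leaff u))) ?cards1.
Qed.

(** Both ends of an edge can be left out: they are independent in [compl G],
    where every vertex misses only itself and its partner. *)
Lemma TOID_compl_degree1 (G : sgraph) :
  5 <= #|G| -> no_isolated G -> (forall v : G, #|nbrs v| <= 1) ->
  TOID_number (compl G) <= #|G| - 2.
Proof.
move=> n5 /no_isolatedP noG le1.
have [a _] : exists a : G, a \in G by apply/card_gt0P; apply: leq_trans n5.
have [b ab] := noG a.
have <- : #|~: [set a; b]| = #|G| - 2 by rewrite cardsCs setCK card_pair ?adj_neq.
apply: (@TOID_number_min (compl G)); apply/TOID_setP; split=> [v|u v].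
  have [u vu] := noG v.
  have [y] : exists y, y \notin [:: a; b; v; u] by apply: ex_notin; apply: n5.
  rewrite !inE !negb_or => /and4P[ya yb yv yu].
  exists y; first by rewrite !inE negb_or ya.
  rewrite adj_compl eq_sym yv; apply: contra yu => vy.
  by apply/eqP/(card_le1_eqP (le1 v)); rewrite in_nbrs.
rewrite !inE !negbK => /orP[]/eqP-> /orP[]/eqP->;
  by rewrite adj_compl ?eqxx // ?[adj b a]adj_sym ab andbF.
Qed.

(** No two nonadjacent vertices can be left out of a total dominating set
    together. *)
Definition crowded (G : sgraph) : Prop :=
  forall u v : G, u != v -> ~~ adj u v -> exists w, nbrs w \subset [set u; v].

Lemma TOID_crowdedP (G : sgraph) :
  no_isolated G -> #|G| <= (TOID_number G).+1 <-> crowded G.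
Proof.
move=> noG; split=> [ge_n u v neq_uv uv|crG].
  apply/existsP; apply: contraT; rewrite negb_exists => /forallP nosub.
  have : TOID_set (~: [set u; v]).
    apply/TOID_setP; split=> [w|w w'].
      have /subsetPn[x] := nosub w; rewrite in_nbrs => wx ux.
      by exists x; rewrite // inE.
    rewrite !inE !negbK => /orP[]/eqP-> /orP[]/eqP->; rewrite ?adj_irrefl //.
    by rewrite adj_sym.
  move/TOID_number_min; rewrite cardsCs setCK card_pair //.
  have : 2 <= #|G| by rewrite -(card_pair neq_uv) max_card.
  lia.
have [S /TOID_setP[domS indS] <-] := TOID_number_attained noG.
suff le1 : #|~: S| <= 1.
  by rewrite -(cardsC S) -addn1 leq_add2l.
apply/card_le1_eqP=> v u; rewrite !inE => vS uS; apply/eqP; apply: contraT => neq_uv.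
have [w /subsetP subw] := crG u v neq_uv (indS u v uS vS).
have [x Sx wx] := domS w; have := subw x; rewrite in_nbrs wx !inE => /(_ isT).
by case/orP=> /eqP eq_x; move: uS vS; rewrite -eq_x Sx.
Qed.

Lemma crowded_complK (G : sgraph) : crowded G -> crowded (compl (compl G)).
Proof.
move=> crG u v neq_uv; rewrite adj_complK => uv.
have [w /subsetP subw] := crG u v neq_uv uv; exists w; apply/subsetP=> x.
by rewrite in_nbrs adj_complK => wx; apply: subw; rewrite in_nbrs.
Qed.

(** Suppose that [x] is a leaf at [u]. The witness that the ends of an edge
    [pq] cannot both be left out of [compl G] must be adjacent in [G] to every
    vertex outside [{p, q}]; when [x] is not in [{p, q}] it is therefore [u],
    since [x] itself misses too many vertices, and every non-neighbour of [u]
    lies in [{p, q}]. The edge [xu] has a witness [w] too,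
    adjacent to all vertices but [x] and [u]. Two edges at [w] show that [w] is
    the only non-neighbour of [u], and then an edge [uy] contradicts this. *)
Lemma crowded_compl_degree (G : sgraph) (x : G) :
  5 <= #|G| -> no_isolated G -> no_isolated (compl G) -> crowded (compl G) ->
  2 <= #|nbrs x|.
Proof.
move=> n5 /no_isolatedP noG /no_isolated_complP noG' crG.
rewrite leqNgt ltnS; apply/negP=> le1.
have [u xu] := noG x.
have onlyu (y : G) : adj x y -> y = u.
  by move=> xy; apply: (card_le1_eqP le1); rewrite in_nbrs.
have wit (p q : G) : adj p q ->
    exists w, forall y, w != y -> ~~ adj w y -> y \in [set p; q].
  move=> pq; have [||w subw] := crG p q; first exact: (adj_neq pq).
    by rewrite adj_compl pq andbF.
  by exists w => y wy nwy; apply: (subsetP subw); rewrite in_nbrs adj_compl wy.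
(* The leaf [x] has at least [n - 2 >= 3] non-neighbours. *)
have far_x (p q : G) : ~ (forall y, x != y -> ~~ adj x y -> y \in [set p; q]).
  move=> sub; have [y] : exists y, y \notin [:: p; q; x; u].
    by apply: ex_notin; apply: n5.
  rewrite !inE !negb_or => /and4P[yp yq yx yu].
  have := sub y; rewrite eq_sym yx !inE (negPf yp) (negPf yq) => /(_ isT) H.
  by have /onlyu eq_yu : adj x y; [apply: contraT => /H | rewrite eq_yu eqxx in yu].
have through_u (p q t : G) : adj p q -> x != p -> x != q -> u != t -> ~~ adj u t ->
    t \in [set p; q].
  move=> /wit[w subw] xp xq.
  have [eq_wx|neq_wx] := eqVneq w x; first by case: (@far_x p q); rewrite -eq_wx.
  have [/onlyu <-|nwx] := boolP (adj x w); first exact: subw.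
  by have := subw x neq_wx; rewrite adj_sym !inE (negPf xp) (negPf xq) => /(_ nwx).
have [w subw] := wit x u xu.
have neq_wx : x != w by apply/eqP=> eq_xw; case: (@far_x x u); rewrite {1 2}eq_xw.
have neq_wu : u != w.
  apply/eqP=> eq_uw; have [t ut nut] := noG' u.
  have := subw t; rewrite -eq_uw !inE => /(_ ut nut) /orP[]/eqP eq_t.
    by rewrite eq_t adj_sym xu in nut.
  by rewrite eq_t eqxx in ut.
have adjw (y : G) : y \notin [:: x; u; w] -> adj w y.
  rewrite !inE !negb_or => /and3P[yx yu yw]; apply: contraT => nwy.
  by have := subw y; rewrite eq_sym yw !inE (negPf yx) (negPf yu) => /(_ isT nwy).
have [y yN] : exists y, y \notin [:: x; u; w].
  by apply: ex_notin; apply: leq_trans n5.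
have [z] : exists z, z \notin [:: y; x; u; w] by apply: ex_notin; apply: n5.
rewrite in_cons negb_or => /andP[neq_zy zN].
have := yN; have := zN.
rewrite !inE !negb_or => /and3P[zx zu zw] /and3P[yx yu yw].
have only_w (t : G) : u != t -> ~~ adj u t -> t = w.
  move=> ut nut.
  have := through_u w y t (adjw y yN) neq_wx; rewrite eq_sym yx => /(_ isT ut nut).
  have := through_u w z t (adjw z zN) neq_wx; rewrite eq_sym zx => /(_ isT ut nut).
  rewrite !inE => /orP[/eqP //|/eqP->]; rewrite (negPf zw) (negPf neq_zy) //.
have uy : adj u y.
  apply: contraT => /only_w eq_yw.
  by rewrite eq_yw ?eqxx // eq_sym in yw.
have [t ut nut] := noG' u.
have := through_u u y t uy (adj_neq xu); rewrite eq_sym yx => /(_ isT ut nut).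
by rewrite (only_w t ut nut) !inE ![w == _]eq_sym (negPf neq_wu) (negPf yw).
Qed.

(** Neighbourhoods have at least two vertices in [G] and in [compl G], so the
    witness for a pair has exactly this pair as its neighbourhood. Every pair is
    nonadjacent in one of the two graphs, hence is one of at most [2n]
    neighbourhoods; ['C(n, 2) <= 2n] leaves only [n = 5]. *)
Lemma crowded_two_regular (G : sgraph) :
  5 <= #|G| -> no_isolated G -> no_isolated (compl G) ->
  crowded G -> crowded (compl G) ->
  #|G| = 5 /\ forall v : G, #|nbrs v| = 2.
Proof.
move=> n5 noG noG' crG crG'.
have deg (v : G) : 2 <= #|nbrs v| by apply: crowded_compl_degree.
have deg' (v : G) : 2 <= #|@nbrs (compl G) v|.
  apply: (@crowded_compl_degree (compl G)) => //; first by rewrite no_isolated_complK.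
  exact: crowded_complK.
suff n_le5 : #|G| <= 5.
  have n_eq5 : #|G| = 5 by lia.
  split=> // v; have := card_nbrs_compl v; have := deg v; have := deg' v; lia.
pose pairs := [set P : {set G} | #|P| == 2].
have sub : pairs \subset [set nbrs v | v : G] :|: [set @nbrs (compl G) v | v : G].
  apply/subsetP=> P; rewrite inE => P2; have /cards2P[u [v [neq_uv defP]]] := P2.
  rewrite inE; apply/orP; have [uv|nuv] := boolP (adj u v).
    right; have [||w subw] := crG' u v; rewrite ?adj_compl ?uv ?andbF //.
    apply/imsetP; exists w => //; apply/eqP.
    by rewrite eq_sym eqEcard defP subw card_pair ?deg'.
  left; have [w subw] := crG u v neq_uv nuv.
  apply/imsetP; exists w => //; apply/eqP.
  by rewrite eq_sym eqEcard defP subw card_pair ?deg.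
have le_l : #|[set nbrs v | v : G]| <= #|G| := leq_imset_card _ _.
have le_r : #|[set @nbrs (compl G) v | v : G]| <= #|G| := leq_imset_card _ _.
have := leq_trans (subset_leq_card sub) (leq_card_setU _ _).
rewrite card_draws bin2 => /leq_trans/(_ (leq_add le_l le_r)).
by move: #|G|; clear => n; nia.
Qed.

(** * The five-cycle *)

Lemma iso_sym (G H : sgraph) : iso G H -> iso H G.
Proof.
case=> f [g fK gK] adjf; exists g; first by exists f.
by move=> u v; rewrite -adjf !gK.
Qed.

Lemma iso_compl (G H : sgraph) : iso G H -> iso (compl G) (compl H).
Proof.
case=> f bij_f adjf; exists f => // u v.
by rewrite !adj_compl adjf (inj_eq (bij_inj bij_f)).
Qed.

Lemma crowded_iso (G H : sgraph) : iso G H -> crowded H -> crowded G.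
Proof.
case=> f [g fK gK] adjf crH u v neq_uv uv.
have [||w /subsetP subw] := crH (f u) (f v); rewrite ?(can_eq fK) ?adjf //.
exists (g w); apply/subsetP=> x; rewrite in_nbrs -adjf gK => wfx.
by have := subw (f x); rewrite in_nbrs !inE !(can_eq fK); apply.
Qed.

(** Nonadjacent vertices lie at distance two, and a common neighbour is the
    witness. *)
Lemma crowded_C5 : crowded C5.
Proof.
move=> u v neq_uv uv.
exists (if v == ordS (ordS u) then ordS u else ordS v).
apply/subsetP=> x; rewrite in_nbrs; move: neq_uv uv; rewrite !inE.
case: u => [[|[|[|[|[|u]]]]] ltu] //; case: v => [[|[|[|[|[|v]]]]] ltv] //;
by case: x => [[|[|[|[|[|x]]]]] ltx].
Qed.

(** The witness for an edge is the opposite vertex. *)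
Lemma crowded_compl_C5 : crowded (compl C5).
Proof.
move=> u v neq_uv uv.
exists (if v == ordS u then ordS (ordS (ordS u)) else ordS (ordS (ordS v))).
apply/subsetP=> x; rewrite in_nbrs; move: neq_uv uv; rewrite !inE.
case: u => [[|[|[|[|[|u]]]]] ltu] //; case: v => [[|[|[|[|[|v]]]]] ltv] //;
by case: x => [[|[|[|[|[|x]]]]] ltx].
Qed.

(** A nonempty set closed under adjacency has at least three vertices, and the
    complement of a closed set is closed. *)
Lemma two_regular5_connected (G : sgraph) (T : {set G}) (x : G) :
  #|G| = 5 -> (forall v : G, #|nbrs v| = 2) ->
  x \in T -> (forall v, v \in T -> nbrs v \subset T) -> T = setT.
Proof.
move=> n5 deg Tx closedT; apply/eqP; rewrite eqEcard subsetT cardsT n5 /=.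
have big (U : {set G}) v :
    v \in U -> (forall v, v \in U -> nbrs v \subset U) -> 3 <= #|U|.
  move=> Uv closedU; have <- : #|v |: nbrs v| = 3.
    by rewrite cardsU1 in_nbrs adj_irrefl deg.
  by rewrite subset_leq_card // subUset sub1set Uv closedU.
have [cT0|[y Ty]] := set_0Vmem (~: T).
  by rewrite -[T]setCK cT0 setC0 cardsT n5.
have : 3 <= #|~: T|.
  apply: big Ty _ => v; rewrite inE => Tv; apply/subsetP=> u; rewrite in_nbrs inE.
  move=> vu; apply: contra Tv => /closedT/subsetP/(_ v).
  by rewrite in_nbrs adj_sym; apply.
have := big T x Tx closedT; have : #|T| + #|~: T| = #|G| := cardsC T.
by rewrite n5; lia.
Qed.

(** Walking from [v0] in both directions gives [v1], [v2] on one side and [v4],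
    [v3] on the other; a coincidence or a chord would close a shorter cycle,
    against connectedness. *)
Lemma two_regular_C5 (G : sgraph) :
  #|G| = 5 -> (forall v : G, #|nbrs v| = 2) -> iso G C5.
Proof.
move=> n5 deg.
have nbrsE (u p q : G) : adj u p -> adj u q -> p != q -> nbrs u = [set p; q].
  move=> up uq neq_pq; apply/eqP; rewrite eq_sym eqEcard deg card_pair //.
  by rewrite subUset !sub1set !in_nbrs up uq.
have other (u v : G) : adj u v -> exists2 w, v != w & adj u w.
  move=> uv; have /card_gt1P[p [q []]] : 1 < #|nbrs u| by rewrite deg.
  rewrite !in_nbrs => up uq neq_pq.
  by have [->|neq_vp] := eqVneq v p; [exists q | exists p].
have [v0 _] : exists v0 : G, v0 \in G by apply/card_gt0P; rewrite n5.
have /card_gt1P[v1 [v4 []]] : 1 < #|nbrs v0| by rewrite deg.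
rewrite !in_nbrs => a01 a04 neq14.
have a10 : adj v1 v0 by rewrite adj_sym.
have a40 : adj v4 v0 by rewrite adj_sym.
have [v2 neq02 a12] := other v1 v0 a10.
have [v3 neq03 a43] := other v4 v0 a40.
have a21 : adj v2 v1 by rewrite adj_sym.
have a34 : adj v3 v4 by rewrite adj_sym.
have N0 := nbrsE v0 v1 v4 a01 a04 neq14.
have N1 := nbrsE v1 v0 v2 a10 a12 neq02.
have N4 := nbrsE v4 v0 v3 a40 a43 neq03.
have closed_small (s : seq G) : size s <= 4 -> v0 \in s ->
    (forall v, v \in s -> nbrs v \subset [set x in s]) -> False.
  move=> s4 s0 closed_s; have sT : [set x in s] = setT.
    apply: (two_regular5_connected n5 deg (x := v0)); first by rewrite inE.
    by move=> v; rewrite inE => /closed_s.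
  by have := leq_trans (card_size s) s4; rewrite -cardsE sT cardsT n5.
have a14 : ~~ adj v1 v4.
  apply/negP=> a14; have a41 : adj v4 v1 by rewrite adj_sym.
  apply: (closed_small [:: v0; v1; v4]); rewrite ?inE ?eqxx //.
  move=> v; rewrite !inE => /or3P[]/eqP->; rewrite ?N0.
  - by rewrite subUset !sub1set !inE !eqxx !orbT.
  - by rewrite (nbrsE v1 v0 v4) ?adj_neq // subUset !sub1set !inE !eqxx !orbT.
  - by rewrite (nbrsE v4 v0 v1) ?adj_neq // subUset !sub1set !inE !eqxx !orbT.
have neq24 : v2 != v4 by apply: contraNneq a14 => <-.
have neq13 : v1 != v3 by apply: contraNneq a14 => ->; rewrite adj_sym.
have neq23 : v2 != v3.
  apply/eqP=> eq23; have a24 : adj v2 v4 by rewrite eq23.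
  apply: (closed_small [:: v0; v1; v2; v4]); rewrite ?inE ?eqxx //.
  move=> v; rewrite !inE => /or4P[]/eqP->; rewrite ?N0 ?N1 ?N4 -?eq23.
  - by rewrite subUset !sub1set !inE !eqxx !orbT.
  - by rewrite subUset !sub1set !inE !eqxx !orbT.
  - by rewrite (nbrsE v2 v1 v4) // subUset !sub1set !inE !eqxx !orbT.
  - by rewrite subUset !sub1set !inE !eqxx !orbT.
pose g (i : C5) := nth v0 [:: v0; v1; v2; v3; v4] i.
have uniq_v : uniq [:: v0; v1; v2; v3; v4].
  rewrite /= !inE !negb_or !(adj_neq a01, adj_neq a04, neq02, neq03).
  by rewrite !(adj_neq a12, neq13, neq14, neq23, neq24, adj_neq a34).
have g_inj : injective g.
  by move=> i j /eqP; rewrite nth_uniq ?ltn_ord // => /eqP/val_inj.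
have g_bij : bijective g by apply: inj_card_bij; rewrite ?card_ord ?n5.
have a23 : adj v2 v3.
  have [w neq_w1 a2w] := other v2 v1 a21.
  have [h _ hK] := g_bij.
  have aw2 : adj w v2 by rewrite adj_sym.
  case: (h w) (hK w) => [[|[|[|[|[|i]]]]] lti] //;
    rewrite /g /= => eq_w.
  - have := aw2; rewrite -eq_w -in_nbrs N0 !inE (negPf neq24) orbF.
    by rewrite eq_sym (negPf (adj_neq a12)).
  - by rewrite eq_w eqxx in neq_w1.
  - by rewrite -eq_w adj_irrefl in a2w.
  - by rewrite eq_w.
  - have := aw2; rewrite -eq_w -in_nbrs N4 !inE eq_sym (negPf neq02).
    by rewrite (negPf neq23).
apply: iso_sym; exists g => // i j.
have Ng : nbrs (g i) = [set g (ordS i); g (ord_pred i)].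
  case: i => [[|[|[|[|[|i]]]]] lti] //; rewrite /g /=.
  - by rewrite N1 setUC.
  - by apply: nbrsE; rewrite // eq_sym.
  - by apply: nbrsE; rewrite // 1?adj_sym // eq_sym.
rewrite -in_nbrs Ng !inE !(inj_eq g_inj) /=; congr (_ || _).
by apply/eqP/eqP=> ->; rewrite ?ord_predK ?ordSK.
Qed.

(** * The product of the two TOID numbers *)

Theorem theorem2p3 (G : sgraph) :
  5 <= #|G| -> no_isolated G -> no_isolated (compl G) ->
  [/\ 2 * #|G| - 6 <= TOID_number G * TOID_number (compl G)
        <= (#|G| - 1) ^ 2,
      TOID_number G * TOID_number (compl G) = 2 * #|G| - 6 <->
        in_Lambda G \/ in_Lambda (compl G) &
      TOID_number G * TOID_number (compl G) = (#|G| - 1) ^ 2 <->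
        iso G C5].
Proof.
move=> n5 noG noG'.
have noGcc : no_isolated (compl (compl G)) by rewrite no_isolated_complK.
have g2 : 2 <= TOID_number G by apply: TOID_number_ge2 => //; apply: leq_trans n5.
have g'2 : 2 <= TOID_number (compl G).
  by apply: TOID_number_ge2 => //; apply: leq_trans n5.
have sum := TOID_number_sum noG noG'.
have gn := TOID_number_le_order noG.
have g'n : TOID_number (compl G) <= #|G| := TOID_number_le_order noG'.
have full : TOID_number G = #|G| -> TOID_number (compl G) <= #|G| - 2.
  by move=> eq_n; apply: TOID_compl_degree1 => // v; apply: TOID_order_degree.
have full' : TOID_number (compl G) = #|G| -> TOID_number G <= #|G| - 2.
  move=> eq_n; rewrite -TOID_number_complK.
  by apply: TOID_compl_degree1 => // v; apply: TOID_order_degree.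
have Lam := @Lambda_TOID_number G.
have Lam' : in_Lambda (compl G) ->
    TOID_number (compl G) <= 2 /\ TOID_number G <= #|G| - 3.
  by move/Lambda_TOID_number; rewrite TOID_number_complK.
have toLam := TOID_number_Lambda n5 noG noG'.
have toLam' : TOID_number (compl G) = 2 -> TOID_number G = #|G| - 3 ->
    in_Lambda (compl G).
  by rewrite -[TOID_number G]TOID_number_complK; apply: TOID_number_Lambda.
have crP := TOID_crowdedP noG; have crP' := TOID_crowdedP noG'.
have toC5 : #|G| <= (TOID_number G).+1 -> #|G| <= (TOID_number (compl G)).+1 ->
    iso G C5.
  move=> /crP crG /crP' crG'.
  have [eq_n5 deg] := crowded_two_regular n5 noG noG' crG crG'.
  exact: two_regular_C5.
have fromC5 : iso G C5 ->
    #|G| <= (TOID_number G).+1 /\ #|G| <= (TOID_number (compl G)).+1.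
  move=> isoG; split; first exact/crP/(crowded_iso isoG)/crowded_C5.
  exact/crP'/(crowded_iso (iso_compl isoG))/crowded_compl_C5.
(* What remains is arithmetic in the order and the two TOID numbers. *)
move: n5 g2 g'2 sum gn g'n full full' Lam Lam' toLam toLam' toC5 fromC5.
move: (TOID_number G) (TOID_number (compl G)) #|G| => c d n; clear.
move=> n5 c2 d2 sum cn dn full full' Lam Lam' toLam toLam' toC5 fromC5.
have lower : 2 * n - 6 <= c * d by nia.
have upper : c * d <= (n - 1) ^ 2.
  have [/full|neq_cn] := eqVneq c n; first by nia.
  have [/full'|neq_dn] := eqVneq d n; first by nia.
  by nia.
split; first by rewrite lower.
- split=> [eq_cd|[/Lam|/Lam'] []]; [|nia|nia].
  have [eq_c2|neq_c2] := eqVneq c 2.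
    by left; apply: toLam; nia.
  by right; apply: toLam'; nia.
split=> [eq_cd|/fromC5[]]; last by nia.
have [/full|neq_cn] := eqVneq c n; first by nia.
have [/full'|neq_dn] := eqVneq d n; first by nia.
by apply: toC5; nia.
Qed.
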